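(* Consider the PtD--PSI scheme with Lax--Friedrichs K-step and centered-difference S- and L-steps (defined in the context), and let $U^n=X^nS^n(V^n)^T$, $n\ge 0$, be its iterates. If the CFL number $\nu=\lambda_{\max}\frac{\Delta t}{\Delta x}>0$ satisfies $\nu\le \frac13$, then $$\|U^{n+1}\|_F\le \|U^n\|_F\qquad\text{for all } n\ge 0.$$
   Context: Let $A\in\mathbb R^{N_v\times N_v}$ be symmetric, $\lambda_{\max}:=\|A\|_2$ (spectral norm), $\Delta t,\Delta x>0$, and $\nu:=\lambda_{\max}\frac{\Delta t}{\Delta x}>0$. $\|\cdot\|_F$ is the Frobenius norm. Let $E_+,E_-\in\mathbb R^{N_x\times N_x}$ be the periodic shift matrices $(E_+w)_j=w_{j+1}$, $(E_-w)_j=w_{j-1}$ (indices modulo $N_x$), and $M_1=E_+-E_-$, $M_2=2I-E_+-E_-$. PtD--PSI (project-then-discretize, projector-splitting integrator) scheme of rank $r\le\min(N_x,N_v)$: the state at time level $n$ is $U^n=X^nS^n(V^n)^T$ with $X^n\in\mathbb R^{N_x\times r}$, $S^n\in\mathbb R^{r\times r}$, $V^n\in\mathbb R^{N_v\times r}$, $(X^n)^TX^n=I_r$, $(V^n)^TV^n=I_r$. One step from $n$ to $n+1$, with $\widetilde A:=(V^n)^TAV^n$, is: K-step: $K^n=X^nS^n$, $K^{n+1}=K^n-\frac{\Delta t}{2\Delta x}M_1K^n\widetilde A-\frac{\nu}{2}M_2K^n$; take a QR factorization $K^{n+1}=X^{n+1}S^{(1)}$ with $X^{n+1}\in\mathbb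 R^{N_x\times r}$ having orthonormal columns and $S^{(1)}\in\mathbb R^{r\times r}$. S-step: $S^{(2)}=S^{(1)}+\frac{\Delta t}{2\Delta x}(X^{n+1})^TM_1X^{n+1}S^{(1)}\widetilde A$. L-step: $L^n=S^{(2)}(V^n)^T$, $L^{n+1}=L^n-\frac{\Delta t}{2\Delta x}(X^{n+1})^TM_1X^{n+1}L^nA$; take a QR factorization $(L^{n+1})^T=V^{n+1}(S^{n+1})^T$ with $V^{n+1}\in\mathbb R^{N_v\times r}$ having orthonormal columns. Then $U^{n+1}=X^{n+1}S^{n+1}(V^{n+1})^T=X^{n+1}L^{n+1}$. *)

(* Defs.v *)
From HB Require Import structures.
From mathcomp Require Import all_boot all_order all_algebra.
From mathcomp Require Import boolp classical_sets reals.

Set Implicit Arguments.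
Unset Strict Implicit.
Unset Printing Implicit Defensive.

Import Order.TTheory GRing.Theory Num.Theory.

Local Open Scope ring_scope.
Local Open Scope classical_set_scope.

Section Norms.
Context {R : realType}.

Definition frobenius_norm m n (M : 'M[R]_(m, n)) : R :=
  Num.sqrt (\sum_i \sum_j M i j ^+ 2).

(* On column vectors [frobenius_norm] is the Euclidean norm, so this is the
   operator norm induced by the Euclidean norms. *)
Definition spectral_norm m n (M : 'M[R]_(m, n)) : R :=
  sup [set frobenius_norm (M *m v) | v in
        [set v : 'cV[R]_n | frobenius_norm v <= 1]].

Definition orthonormal_cols m n (Q : 'M[R]_(m, n)) : Prop := Q^T *m Q = 1%:M.

(* Reduced QR factorization M = Q T. MathComp's [is_trig_mx] means lower
   triangular, hence the transpose. No sign or rank condition is imposed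
   on T: when M is rank deficient, any orthonormal completion Q is allowed. *)
Definition is_QR m n (M Q : 'M[R]_(m, n)) (T : 'M[R]_n) : Prop :=
  [/\ M = Q *m T, orthonormal_cols Q & is_trig_mx T^T].

End Norms.

Section Scheme.
Context {R : realType} {Nx Nv r : nat}.
Implicit Types (A : 'M[R]_Nv) (dt dx : R).

(* [ordS] and [ord_pred] are the cyclic successor and predecessor. *)
Definition shift_plus : 'M[R]_Nx := \matrix_(i, j) (j == ordS i)%:R.
Definition shift_minus : 'M[R]_Nx := \matrix_(i, j) (j == ord_pred i)%:R.

Definition M1 : 'M[R]_Nx := shift_plus - shift_minus.
Definition M2 : 'M[R]_Nx := 2%:M - shift_plus - shift_minus.

Definition cfl A dt dx : R := spectral_norm A * (dt / dx).

Definition projected A (V : 'M[R]_(Nv, r)) : 'M[R]_r := V^T *m A *m V.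

Definition K_step A dt dx (V : 'M[R]_(Nv, r)) (K : 'M[R]_(Nx, r)) :
    'M[R]_(Nx, r) :=
  K - (dt / (2 * dx)) *: (M1 *m K *m projected A V)
    - (cfl A dt dx / 2) *: (M2 *m K).

Definition S_step A dt dx (V : 'M[R]_(Nv, r)) (X' : 'M[R]_(Nx, r))
    (S1 : 'M[R]_r) : 'M[R]_r :=
  S1 + (dt / (2 * dx)) *: (X'^T *m M1 *m X' *m S1 *m projected A V).

Definition L_step A dt dx (X' : 'M[R]_(Nx, r)) (L : 'M[R]_(r, Nv)) :
    'M[R]_(r, Nv) :=
  L - (dt / (2 * dx)) *: (X'^T *m M1 *m X' *m L *m A).

(* QR factorizations are not unique, so one time step is a relation between
   the factors (X, S, V) and (X', S', V'). *)
Definition psi_step A dt dx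
    (X : 'M[R]_(Nx, r)) (S : 'M[R]_r) (V : 'M[R]_(Nv, r))
    (X' : 'M[R]_(Nx, r)) (S' : 'M[R]_r) (V' : 'M[R]_(Nv, r)) : Prop :=
  exists S1 : 'M[R]_r,
    is_QR (K_step A dt dx V (X *m S)) X' S1 /\
    let S2 := S_step A dt dx V X' S1 in
    is_QR (L_step A dt dx X' (S2 *m V^T))^T V' S'^T.

(* Orthonormality at later time levels follows from the QR factorizations. *)
Definition psi_iterates A dt dx (X : nat -> 'M[R]_(Nx, r))
    (S : nat -> 'M[R]_r) (V : nat -> 'M[R]_(Nv, r)) : Prop :=
  [/\ orthonormal_cols (X 0%N), orthonormal_cols (V 0%N) &
      forall n, psi_step A dt dx (X n) (S n) (V n) (X n.+1) (S n.+1) (V n.+1)].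

Definition low_rank_state (X : 'M[R]_(Nx, r)) (S : 'M[R]_r)
    (V : 'M[R]_(Nv, r)) : 'M[R]_(Nx, Nv) := X *m S *m V^T.

End Scheme.

(* Main.v *)
Require Import Defs.
From HB Require Import structures.
From mathcomp Require Import all_boot all_order all_algebra.
From mathcomp Require Import boolp classical_sets reals.
From mathcomp Require Import ring lra.
Set Implicit Arguments.
Unset Strict Implicit.
Unset Printing Implicit Defensive.
Import Order.TTheory GRing.Theory Num.Theory.
Local Open Scope ring_scope.

(** The three substeps are energy estimates in the squared Frobenius norm |.|^2.
  Let E be the cyclic shift, N = E - 1, h = nu / 2 and D = X'^T M1 X', a
  skew matrix.  Since M1 = (1 + E^T) N and M2 = N^T N = (E^T - 1) N, the
  parallelogram law gives |M1 Z|^2 + |M2 Z|^2 = 4 |N Z|^2, and as skew terms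
  drop out, the K-step dissipates:
    |K'|^2 <= |K|^2 - nu (1 - nu) |N K|^2.
  The S- and L-steps can only produce energy, at most h^2 |D S1|^2 and
  h^2 |D S2|^2 <= h^2 (|D S1|^2 + h^2 |D D S1|^2).  Bounding |D| by 2 would
  only give stability for 3 nu + nu^3 <= 1.  To reach nu <= 1/3, put
  w = M1 K' and let y be its projection onto the range of X', so that
  |D S1| = |y| and |D D S1| <= |M1 y|.  Then |M1 y|^2 is absorbed partly by
  the projection defect |w - y|^2 = |w|^2 - |y|^2 and partly by the term
  |M2 K'|^2 in |w|^2 = 4 |N K'|^2 - |M2 K'|^2. *)

(** * Frobenius inner product: projections and skew terms *)

Section FrobeniusProduct.
Context {R : realFieldType}.

(** The Frobenius inner product, in trace form so that cyclicity moves a factor to the other side as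
    its transpose. *)
Definition fdot m n (B C : 'M[R]_(m, n)) : R := \tr (B^T *m C).
Definition fsq m n (B : 'M[R]_(m, n)) : R := fdot B B.

Lemma fdotC m n (B C : 'M[R]_(m, n)) : fdot B C = fdot C B.
Proof. by rewrite /fdot -mxtrace_tr trmx_mul trmxK. Qed.

Lemma fdotDr m n (B C D : 'M[R]_(m, n)) : fdot B (C + D) = fdot B C + fdot B D.
Proof. by rewrite /fdot mulmxDr mxtraceD. Qed.

Lemma fdotZr m n a (B C : 'M[R]_(m, n)) : fdot B (a *: C) = a * fdot B C.
Proof. by rewrite /fdot -scalemxAr mxtraceZ. Qed.

Lemma fdotNr m n (B C : 'M[R]_(m, n)) : fdot B (- C) = - fdot B C.
Proof. by rewrite -scaleN1r fdotZr mulN1r. Qed.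

Lemma fdot_mull m n p (G : 'M[R]_(m, n)) (B : 'M_(n, p)) (C : 'M_(m, p)) :
  fdot (G *m B) C = fdot B (G^T *m C).
Proof. by rewrite /fdot trmx_mul mulmxA. Qed.

Lemma fdot_mulr m n p (B : 'M[R]_(m, n)) (H : 'M_(n, p)) (C : 'M_(m, p)) :
  fdot (B *m H) C = fdot B (C *m H^T).
Proof. by rewrite /fdot trmx_mul -mulmxA mxtrace_mulC mulmxA. Qed.

Lemma fsqE m n (B : 'M[R]_(m, n)) : fsq B = \sum_i \sum_j B i j ^+ 2.
Proof.
rewrite /fsq /fdot /mxtrace exchange_big; apply: eq_bigr => j _.
by rewrite mxE; apply: eq_bigr => i _; rewrite mxE expr2.
Qed.

Lemma fsq_ge0 m n (B : 'M[R]_(m, n)) : 0 <= fsq B.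
Proof. by rewrite fsqE; do 2!apply: sumr_ge0 => ? _; exact: sqr_ge0. Qed.

Lemma fsqD m n (B C : 'M[R]_(m, n)) :
  fsq (B + C) = fsq B + 2 * fdot B C + fsq C.
Proof.
by rewrite /fsq fdotDr ![fdot (B + C) _]fdotC !fdotDr (fdotC C B); ring.
Qed.

Lemma fsqZ m n a (B : 'M[R]_(m, n)) : fsq (a *: B) = a ^+ 2 * fsq B.
Proof. by rewrite /fsq fdotZr fdotC fdotZr; ring. Qed.

Lemma fsqN m n (B : 'M[R]_(m, n)) : fsq (- B) = fsq B.
Proof. by rewrite /fsq fdotNr fdotC fdotNr opprK. Qed.

Lemma fsqT m n (B : 'M[R]_(m, n)) : fsq B^T = fsq B.
Proof. by rewrite /fsq /fdot trmxK mxtrace_mulC. Qed.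

Lemma fsq_parallelogram m n (B C : 'M[R]_(m, n)) :
  fsq (B + C) + fsq (B - C) = 2 * fsq B + 2 * fsq C.
Proof. by rewrite !fsqD fdotNr fsqN; ring. Qed.

Lemma fsqD_le m n (B C : 'M[R]_(m, n)) : fsq (B + C) <= 2 * fsq B + 2 * fsq C.
Proof. by rewrite -fsq_parallelogram lerDl fsq_ge0. Qed.

Lemma fsq_isometry m n p (Q : 'M[R]_(m, n)) (B : 'M_(n, p)) :
  Q^T *m Q = 1%:M -> fsq (Q *m B) = fsq B.
Proof. by move=> QQ; rewrite /fsq fdot_mull mulmxA QQ mul1mx. Qed.

(** Pythagoras for the orthogonal projection [Q *m Q^T] onto the range of [Q]. *)
Lemma fsq_proj m n p (Q : 'M[R]_(m, n)) (B : 'M_(m, p)) :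
  Q^T *m Q = 1%:M ->
  fsq B = fsq (Q^T *m B) + fsq (B - Q *m (Q^T *m B)).
Proof.
move=> QQ; rewrite fsqD fsqN fdotNr (fsq_isometry _ QQ) (fdotC B) fdot_mull.
by rewrite -/(fsq _); ring.
Qed.

Lemma fsq_trproj_le m n p (Q : 'M[R]_(m, n)) (B : 'M_(m, p)) :
  Q^T *m Q = 1%:M -> fsq (Q^T *m B) <= fsq B.
Proof. by move=> QQ; rewrite (fsq_proj B QQ) lerDl fsq_ge0. Qed.

(** The map [Z |-> G *m Z *m H] is skew-adjoint, so its quadratic form is its own negative. *)
Lemma fdot_skew_sym m n (G : 'M[R]_m) (Z : 'M_(m, n)) (H : 'M_n) :
  G^T = - G -> H^T = H -> fdot Z (G *m Z *m H) = 0.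
Proof.
move=> GN HT; set t := fdot _ _.
have : t = - t.
  by rewrite {1}/t fdotC fdot_mulr HT fdot_mull GN mulNmx fdotNr mulmxA.
lra.
Qed.

Lemma fsq_skew_step m n c (G : 'M[R]_m) (Z : 'M_(m, n)) (H : 'M_n) :
  G^T = - G -> H^T = H ->
  fsq (Z + c *: (G *m Z *m H)) = fsq Z + c ^+ 2 * fsq (G *m Z *m H).
Proof. by move=> GN HT; rewrite fsqD fdotZr fdot_skew_sym // fsqZ; ring. Qed.

End FrobeniusProduct.

(** * Periodic shifts and difference operators *)

Section PeriodicShift.
Context {R : realType} {n : nat}.
Local Notation E := (@shift_plus R n).

Definition forward_diff : 'M[R]_n := E - 1%:M.
Local Notation N := forward_diff.

Lemma shift_minusE : @shift_minus R n = E^T.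
Proof.
apply/matrixP=> i j; rewrite !mxE; congr (_%:R).
by congr nat_of_bool; apply/eqP/eqP => ->; rewrite ?ordSK ?ord_predK.
Qed.

Lemma shift_plus_orthl : E^T *m E = 1%:M.
Proof.
apply: mulmx1C; apply/matrixP => i j; rewrite !mxE (bigD1 (ordS i)) //= !mxE.
rewrite eqxx mul1r (inj_eq (can_inj (@ordSK n))) big1 ?addr0 // => k /negbTE.
by rewrite !mxE => ->; rewrite mul0r.
Qed.

Lemma shift_plus_orthr : E *m E^T = 1%:M.
Proof. exact: mulmx1C shift_plus_orthl. Qed.

Lemma M1E : @M1 R n = E - E^T. Proof. by rewrite /M1 shift_minusE. Qed.

Lemma M1_skew : (@M1 R n)^T = - M1.
Proof. by rewrite M1E linearB /= trmxK opprB. Qed.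

Lemma M2_tr : (@M2 R n)^T = M2.
Proof. by rewrite /M2 shift_minusE !linearB /= tr_scalar_mx trmxK addrAC. Qed.

Lemma M1_diff : @M1 R n = N + E^T *m N.
Proof.
by rewrite M1E /N mulmxBr mulmx1 shift_plus_orthl addrA subrK.
Qed.

Lemma M2_diff : @M2 R n = E^T *m N - N.
Proof.
rewrite /M2 shift_minusE /N mulmxBr mulmx1 shift_plus_orthl.
apply/matrixP=> i j; rewrite !mxE mulr2n ; ring.
Qed.

Lemma diff_tr : N^T = - (E^T *m N).
Proof.
by rewrite /N linearB /= trmx1 mulmxBr mulmx1 shift_plus_orthl opprB.
Qed.

(** Summation by parts: pairing [M2 *m Z] with [Z] yields [|N Z|^2]. *)
Lemma M2_gram : @M2 R n = N^T *m N.
Proof.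
have -> : N^T = E^T - 1%:M by rewrite linearB /= trmx1.
by rewrite M2_diff mulmxBl mul1mx.
Qed.

Lemma shift_comm : E^T *m E = E *m E^T.
Proof. by rewrite shift_plus_orthl shift_plus_orthr. Qed.

Lemma diff_trC : N *m E^T = E^T *m N.
Proof. by rewrite /N mulmxBl mulmxBr shift_comm mul1mx mulmx1. Qed.

Lemma diff_M1C : N *m M1 = M1 *m N.
Proof. by rewrite M1_diff [LHS]mulmxDr [RHS]mulmxDl mulmxA diff_trC. Qed.

Lemma diff_M2C : N *m M2 = M2 *m N.
Proof. by rewrite M2_diff [LHS]mulmxBr [RHS]mulmxBl mulmxA diff_trC. Qed.

(** Commutation makes [M2 *m M1] skew, which kills the cross term between transport and
    diffusion. *)
Lemma M1_M2C : M1 *m M2 = M2 *m M1 :> 'M[R]_n.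
Proof.
have C : M2 *m E^T = E^T *m M2 :> 'M[R]_n.
  by rewrite M2_diff [LHS]mulmxBl [RHS]mulmxBr -!mulmxA diff_trC.
by rewrite M1_diff [LHS]mulmxDl [RHS]mulmxDr mulmxA C -!mulmxA diff_M2C.
Qed.

(** * Energy estimates for the difference operators and the Lax-Friedrichs step *)

Section Estimates.
Context {p : nat}.
Implicit Types Z : 'M[R]_(n, p).

Lemma fsq_shift Z : fsq (E *m Z) = fsq Z.
Proof. exact: fsq_isometry shift_plus_orthl. Qed.

Lemma fsq_shift_tr Z : fsq (E^T *m Z) = fsq Z.
Proof. by apply: fsq_isometry; rewrite trmxK shift_plus_orthr. Qed.

Lemma fsq_M1_M2 Z : fsq (M1 *m Z) + fsq (M2 *m Z) = 4 * fsq (N *m Z).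
Proof.
rewrite M1_diff M2_diff [_ *m _]mulmxDl [X in _ + fsq X]mulmxBl addrC [N *m Z + _]addrC addrC.
by rewrite fsq_parallelogram -mulmxA fsq_shift_tr; ring.
Qed.

Lemma fsq_M1_diff_le Z : fsq (M1 *m Z) <= 4 * fsq (N *m Z).
Proof. by rewrite -fsq_M1_M2 lerDl fsq_ge0. Qed.

Lemma fsq_M1_le Z : fsq (M1 *m Z) <= 4 * fsq Z.
Proof.
have := fsqD_le (E *m Z) (- (E^T *m Z)).
by rewrite fsqN fsq_shift fsq_shift_tr M1E mulmxBl; lra.
Qed.

(** Each [M1] costs a factor 4 against [N], and [N *m N] differs from [M2 = N^T *m N] only by a
    shift and a sign. *)
Lemma fsq_M1_M1_le Z : fsq (M1 *m (M1 *m Z)) <= 16 * fsq (M2 *m Z).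
Proof.
have a := fsq_M1_diff_le (M1 *m Z); have b := fsq_M1_diff_le (N *m Z).
have c : fsq (M2 *m Z) = fsq (N *m (N *m Z)).
  by rewrite M2_gram diff_tr mulNmx mulNmx fsqN -!mulmxA fsq_shift_tr.
by move: a; rewrite [N *m (M1 *m Z)]mulmxA diff_M1C -mulmxA c; lra.
Qed.

Definition lax_friedrichs mu h (H : 'M[R]_p) Z : 'M[R]_(n, p) :=
  Z - mu *: (M1 *m Z *m H) - h *: (M2 *m Z).

(** Lets the energy estimate of the step also control the differences of the new state. *)
Lemma diff_lax_friedrichs mu h H Z :
  N *m lax_friedrichs mu h H Z = lax_friedrichs mu h H (N *m Z).
Proof.
by rewrite /lax_friedrichs !mulmxBr -!scalemxAr !mulmxA diff_M1C diff_M2C.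
Qed.

(** The bound on [H] turns the second-order terms into [h^2 (|M1 Z|^2 + |M2 Z|^2) = 4 h^2 |N Z|^2];
    diffusion paired with [Z] supplies [- 2 h |N Z|^2]. *)
Lemma fsq_lax_friedrichs mu h (H : 'M[R]_p) Z :
  H^T = H -> (forall B : 'M_(n, p), mu ^+ 2 * fsq (B *m H) <= h ^+ 2 * fsq B) ->
  fsq (lax_friedrichs mu h H Z)
    <= fsq Z - 2 * h * (1 - 2 * h) * fsq (N *m Z).
Proof.
move=> HT HB; rewrite /lax_friedrichs -scaleNr fsqD fsq_skew_step ?M1_skew //.
rewrite fdotNr fdotZr fdotC fdotDr fdotZr fsqN fsqZ.
have -> : fdot (M2 *m Z) Z = fsq (N *m Z).
  by rewrite M2_gram -mulmxA fdot_mull trmxK.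
have -> : fdot (M2 *m Z) (M1 *m Z *m H) = 0.
  rewrite fdot_mull M2_tr !mulmxA fdot_skew_sym //.
  by rewrite trmx_mul M1_skew M2_tr mulNmx M1_M2C.
rewrite sqrrN; have := HB (M1 *m Z); have := fsq_M1_M2 Z.
move: (fsq (M1 *m Z)) (fsq (M2 *m Z)) (fsq (N *m Z)) => a b c abc.
have -> : a = 4 * c - b by lra.
lra.
Qed.

End Estimates.
End PeriodicShift.

(** * The spectral norm as a bound for matrix products *)

Section SpectralNorm.
Context {R : realType}.

Lemma frobenius_normE m n (B : 'M[R]_(m, n)) :
  frobenius_norm B = Num.sqrt (fsq B).
Proof. by rewrite fsqE. Qed.

Lemma fsq_le_sqr m n (B : 'M[R]_(m, n)) a :
  0 <= a -> (frobenius_norm B <= a) = (fsq B <= a ^+ 2).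
Proof.
move=> a0; rewrite frobenius_normE -[X in _ <= X]ger0_norm // -sqrtr_sqr.
by rewrite ler_sqrt ?sqr_ge0.
Qed.

(** Ensures that the supremum dominates its members. Entries of [v] in the unit ball are at most 1
    in absolute value, so absolute row sums bound [B *m v]. *)
Lemma has_ubound_spectral m n (B : 'M[R]_(m, n)) :
  has_ubound [set frobenius_norm (B *m v) | v in
    [set v : 'cV[R]_n | frobenius_norm v <= 1]]%classic.
Proof.
exists (Num.sqrt (\sum_i \sum_(j < 1) (\sum_k `|B i k|) ^+ 2)) => _ [v v1 <-].
have {}v1 : fsq v <= 1 by rewrite -(expr1n _ 2) -fsq_le_sqr.
apply: ler_wsqrtr; apply: ler_sum => i _; apply: ler_sum => j _.
rewrite -[leLHS]real_normK ?num_real //.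
rewrite ler_sqr ?nnegrE ?normr_ge0 ?sumr_ge0 // mxE.
apply: le_trans (ler_norm_sum _ _ _) _; apply: ler_sum => k _.
rewrite normrM ler_piMr // -(@ler_sqr _ `|_|) ?nnegrE // expr1n.
rewrite real_normK ?num_real //; apply: le_trans v1; rewrite fsqE (bigD1 k) //=.
rewrite big_ord1 ord1 lerDl; do 2!apply: sumr_ge0 => ? _; exact: sqr_ge0.
Qed.

Lemma fsq_mul_spectral_col m n (B : 'M[R]_(m, n)) (v : 'cV_n) :
  fsq (B *m v) <= spectral_norm B ^+ 2 * fsq v.
Proof.
have [v0|v0] := eqVneq (fsq v) 0.
  suff -> : v = 0 by rewrite mulmx0 /fsq /fdot !mulmx0 !mxtrace0 mulr0.
  apply/colP=> i; rewrite mxE; apply/eqP; rewrite -sqrf_eq0 eq_le sqr_ge0 andbT.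
  rewrite -v0 fsqE (bigD1 i) //= big_ord1 lerDl.
  by do 2!apply: sumr_ge0 => ? _; exact: sqr_ge0.
have vp : 0 < fsq v by rewrite lt_def v0 fsq_ge0.
pose c := (Num.sqrt (fsq v))^-1.
have c2 : c ^+ 2 = (fsq v)^-1 by rewrite exprVn sqr_sqrtr ?fsq_ge0.
have : frobenius_norm (B *m (c *: v)) <= spectral_norm B.
  apply: (ub_le_sup (has_ubound_spectral B)); exists (c *: v) => //=.
  by rewrite fsq_le_sqr ?ler01 // fsqZ c2 mulVf // expr1n.
move=> le; have s0 : 0 <= spectral_norm B by apply: le_trans le; exact: sqrtr_ge0.
by move: le; rewrite fsq_le_sqr // -scalemxAr fsqZ c2 mulrC ler_pdivrMr.
Qed.

Lemma fsq_cols m n (B : 'M[R]_(m, n)) : fsq B = \sum_j fsq (col j B).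
Proof.
rewrite fsqE exchange_big; apply: eq_bigr => j _; rewrite fsqE.
by apply: eq_bigr => i _; rewrite big_ord1 mxE.
Qed.

Lemma fsq_mul_spectral m n p (B : 'M[R]_(m, n)) (C : 'M_(n, p)) :
  fsq (B *m C) <= spectral_norm B ^+ 2 * fsq C.
Proof.
rewrite (fsq_cols C) fsq_cols mulr_sumr; apply: ler_sum => j _.
by rewrite colE -mulmxA -colE fsq_mul_spectral_col.
Qed.

Lemma fsq_mulr_spectral m n (A : 'M[R]_n) (B : 'M_(m, n)) :
  A^T = A -> fsq (B *m A) <= spectral_norm A ^+ 2 * fsq B.
Proof.
by move=> AT; rewrite -fsqT trmx_mul AT -(fsqT B) fsq_mul_spectral.
Qed.

(** Right multiplication by [V^T] is isometric and by [V] contractive, so the bound for [A] survives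
    projection. *)
Lemma fsq_mulr_projected m n r (A : 'M[R]_n) (V : 'M_(n, r)) (B : 'M_(m, r)) :
  A^T = A -> orthonormal_cols V ->
  fsq (B *m projected A V) <= spectral_norm A ^+ 2 * fsq B.
Proof.
move=> AT VV; rewrite /projected !mulmxA -fsqT trmx_mul.
apply: le_trans (fsq_trproj_le _ VV) _; rewrite fsqT.
apply: le_trans (fsq_mulr_spectral _ AT) _.
by rewrite -fsqT trmx_mul trmxK fsq_isometry // fsqT.
Qed.

End SpectralNorm.

(** * Energy balance of one time step *)

Section OneStep.
Context {R : realType} {n r : nat}.

(* [1 / 72] is [h ^+ 2 / 2] at the largest admissible CFL number. *)
Lemma skew_production_le (X : 'M[R]_(n, r)) (S D : 'M_r) :
  orthonormal_cols X -> D = X^T *m M1 *m X ->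
  fsq (D *m S) + 1 / 72 * fsq (D *m (D *m S))
    <= 4 * fsq (forward_diff *m (X *m S)).
Proof.
move=> XX defD; set K := X *m S; set w := M1 *m K.
have DS : D *m S = X^T *m w by rewrite defD /w /K !mulmxA.
have DDS : D *m (D *m S) = X^T *m (M1 *m (X *m (X^T *m w))).
  by rewrite DS defD -!mulmxA.
set y := X *m (X^T *m w) in DDS.
have a := fsq_trproj_le (M1 *m y) XX; rewrite -DDS in a.
have b := fsq_proj w XX; rewrite -/y -DS in b.
have c : fsq (M1 *m y) <= 2 * fsq (M1 *m w) + 2 * fsq (M1 *m (w - y)).
  rewrite -[fsq (_ *m (w - y))]fsqN -mulmxN opprB -[in leLHS](addrNK w y).
  by rewrite addrC mulmxDr fsqD_le.
have d := fsq_M1_le (w - y).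
have e := fsq_M1_M1_le K; rewrite -/w in e.
have f := fsq_M1_M2 K; rewrite -/w in f.
(* [|D D S|^2 <= 32 |M2 K|^2 + 8 |w - y|^2], while [|D S|^2 = 4 |N K|^2 - |M2 K|^2 - |w - y|^2];
   both 32/72 and 8/72 are below 1. *)
have := fsq_ge0 (w - y); have := fsq_ge0 (M2 *m K).
lra.
Qed.

Lemma fsq_psi_step m (A : 'M[R]_m) (dt dx : R) X S V X' S' V' :
  A^T = A -> orthonormal_cols X -> orthonormal_cols V ->
  0 < cfl A dt dx -> cfl A dt dx <= 1 / 3 ->
  psi_step A dt dx X S V X' S' V' ->
  fsq (low_rank_state X' S' V') <= fsq (@low_rank_state R n m r X S V).
Proof.
move=> AT XX VV nu0 nu1 [S1 [[KE XX' _]]] /= [LE VV' _].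
set mu := dt / (2 * dx) in KE LE; set h := cfl A dt dx / 2 in KE.
have muh : mu ^+ 2 * spectral_norm A ^+ 2 = h ^+ 2.
  by rewrite /mu /h /cfl invfM; ring.
set H := projected A V in KE LE.
have HT : H^T = H by rewrite /H /projected !trmx_mul trmxK AT mulmxA.
have HB q (B : 'M_(q, r)) : mu ^+ 2 * fsq (B *m H) <= h ^+ 2 * fsq B.
  by rewrite -muh -mulrA ler_wpM2l ?sqr_ge0 // fsq_mulr_projected.
have AB q (B : 'M_(q, m)) : mu ^+ 2 * fsq (B *m A) <= h ^+ 2 * fsq B.
  by rewrite -muh -mulrA ler_wpM2l ?sqr_ge0 // fsq_mulr_spectral.
have VT q (B : 'M_(q, r)) : fsq (B *m V^T) = fsq B.
  by rewrite -fsqT trmx_mul trmxK fsq_isometry // fsqT.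
set D := X'^T *m M1 *m X' in LE.
have DT : D^T = - D.
  by rewrite /D !trmx_mul trmxK M1_skew mulNmx mulmxN mulmxA.
set S2 := S_step _ _ _ _ _ _ in LE.
have S2E : S2 = S1 + mu *: (D *m S1 *m H) by [].
set L := S2 *m V^T in LE.
have LE' : L_step A dt dx X' L = S' *m V'^T.
  by rewrite -[LHS]trmxK LE trmx_mul trmxK.
have -> : fsq (low_rank_state X' S' V') = fsq (L_step A dt dx X' L).
  by rewrite LE' /low_rank_state -mulmxA fsq_isometry.
have -> : fsq (low_rank_state X S V) = fsq (X *m S) by rewrite VT.
set K := X *m S in KE *.
have KE' : lax_friedrichs mu h H K = X' *m S1 by [].
have dissip := fsq_lax_friedrichs K HT (@HB n).
have contr := fsq_lax_friedrichs (forward_diff *m K) HT (@HB n).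
rewrite -diff_lax_friedrichs KE' in contr; rewrite KE' fsq_isometry // in dissip.
have prod := skew_production_le S1 XX' (erefl D).
have sS2 : fsq S2 <= fsq S1 + h ^+ 2 * fsq (D *m S1).
  by rewrite S2E fsq_skew_step // lerD2l HB.
(* [D *m S2] is itself a skew step, started from [D *m S1]. *)
have sDS2 : fsq (D *m S2) <= fsq (D *m S1) + h ^+ 2 * fsq (D *m (D *m S1)).
  rewrite S2E mulmxDr -scalemxAr [D *m (_ *m H)]mulmxA fsq_skew_step //.
  by rewrite lerD2l HB.
have sL : fsq (L_step A dt dx X' L) <= fsq S2 + h ^+ 2 * fsq (D *m S2).
  rewrite /L_step -/mu -/D -scaleNr fsq_skew_step // sqrrN.
  by rewrite VT lerD2l (le_trans (AB _ _)) // mulmxA VT.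
have h0 : 0 < h by rewrite /h; lra.
have h1 : h <= 1 / 6 by rewrite /h; lra.
have hh : h ^+ 2 <= 1 / 36 by nra.
have d0 := fsq_ge0 (D *m (D *m S1)).
have q0 := fsq_ge0 (forward_diff *m (forward_diff *m K)).
have n0 := fsq_ge0 (forward_diff *m K).
move: sL sS2 sDS2 dissip contr prod d0 q0 n0.
move: (fsq (L_step _ _ _ _ _)) (fsq S2) (fsq (D *m S2)) (fsq S1).
move: (fsq (D *m (D *m S1))) (fsq (D *m S1)) (fsq K).
move: (fsq (forward_diff *m (X' *m S1))).
move: (fsq (forward_diff *m (forward_diff *m K))) (fsq (forward_diff *m K)).
(* Here [a], [b], [c] are the energies of [D S1], [D D S1], [D S2], and [d], [d'] those of [N K] and
   [N K'], where [K' = X' *m S1]. *)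
clear -h0 h1 hh; move=> q d d' b a k l s2 c s1 sL sS2 sDS2 dissip contr prod b0 q0 n0.
have {}contr : d' <= d.
  apply: le_trans contr _; rewrite gerBl mulr_ge0 // mulr_ge0 //; lra.
(* [c + a <= 2 a + h^2 b <= 2 (a + b / 72) <= 8 d' <= 8 d], using [h^2 <= 1/36]. *)
have hb : h ^+ 2 * c + h ^+ 2 * a <= h ^+ 2 * (8 * d).
  by rewrite -mulrDr ler_wpM2l ?sqr_ge0 //; nra.
(* Reduces to [12 h^2 <= 2 h], that is [h <= 1/6]: the CFL bound in full. *)
have : h ^+ 2 * (8 * d) <= 2 * h * (1 - 2 * h) * d.
  rewrite mulrA ler_wpM2r //.
  have : 0 <= h * (1 / 6 - h) by rewrite mulr_ge0 ?subr_ge0 // ltW.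
  lra.
lra.
Qed.

End OneStep.

Theorem theorem3p6 (R : realType) (Nx Nv r : nat) (A : 'M[R]_Nv) (dt dx : R)
    (X : nat -> 'M[R]_(Nx, r)) (S : nat -> 'M[R]_r) (V : nat -> 'M[R]_(Nv, r)) :
  (r <= minn Nx Nv)%N ->
  A^T = A ->
  0 < dt -> 0 < dx ->
  psi_iterates A dt dx X S V ->
  0 < cfl A dt dx -> cfl A dt dx <= 1 / 3 ->
  forall n : nat,
    frobenius_norm (low_rank_state (X n.+1) (S n.+1) (V n.+1))
      <= frobenius_norm (low_rank_state (X n) (S n) (V n)).
Proof.
move=> _ AT _ _ [X0 V0 step] nu0 nu1 n; rewrite !frobenius_normE ler_wsqrtr //.
(* Level 0 is orthonormal by assumption, later levels by the QR factorizations of the preceding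
   step. *)
have [Xn Vn] : orthonormal_cols (X n) /\ orthonormal_cols (V n).
  by case: n => // n; have [S1 [[_ ? _] [_ ? _]]] := step n.
exact: fsq_psi_step nu0 nu1 (step n).
Qed.
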